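(* For $k=1,2$ let $t_k\in\mathbb{C}$ be a $6$th root of unity, $T_k\in\{e^{2\pi i/3},e^{-2\pi i/3}\}$, $\omega_k\in\{e^{i\pi/3},e^{-i\pi/3}\}$, and let $c_k,d_k\in\mathbb{C}$ satisfy $d_k\neq 0$, $c_k\neq 0$ and $c_k\neq\omega_kd_k^2$. Assume that either ($T_1=e^{2\pi i/3}$ and $T_2=e^{-2\pi i/3}$) or $T_1=T_2$. Let $\rho_k=\rho(T_k,t_k,\omega_kd_k,c_k,d_k)$ be the corresponding $2$-dimensional representation of the necklace braid group $\mathcal{NB}_3$, and let $\rho=\rho_1\otimes\rho_2:\mathcal{NB}_3\to GL(4,\mathbb{C})$. Then $\rho$ is irreducible if and only if one of the following conditions holds: 1. $T_1=e^{2\pi i/3}$, $T_2=e^{-2\pi i/3}$ and $\omega_1\omega_2\neq 1$; 2. $T_1=e^{2\pi i/3}$, $T_2=e^{-2\pi i/3}$ and $\omega_1d_1^2c_2\neq\omega_2d_2^2c_1$; 3. $T_1=T_2=e^{\pm2\pi i/3}$ and $\omega_1\neq\omega_2$; 4. $T_1=T_2=e^{\pm2\pi i/3}$ and $\omega_1d_1^2c_2\neq\omega_2d_2^2c_1$.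
   Context: The necklace braid group $\mathcal{NB}_n$ is the group with generators $\sigma_1,\dots,\sigma_n,\tau$ and relations (indices taken modulo $n$, so $\sigma_{n+1}=\sigma_1$): $\sigma_i\sigma_{i+1}\sigma_i=\sigma_{i+1}\sigma_i\sigma_{i+1}$; $\sigma_i\sigma_j=\sigma_j\sigma_i$ whenever $i-j\not\equiv\pm1 \pmod n$; $\tau\sigma_i\tau^{-1}=\sigma_{i+1}$; $\tau^{2n}=1$. For the parameters considered, $\rho(T,t,a,c,d)$ denotes the representation of $\mathcal{NB}_n$ on $\mathbb{C}^2$ with $\tau\mapsto\begin{pmatrix}Tt&0\\0&t\end{pmatrix}$ and $\sigma_i\mapsto\begin{pmatrix}a&T^{i-1}\\ cT^{1-i}&d\end{pmatrix}$ for $1\le i\le n$ (here $n=3$ and $a=\omega d$). The tensor product is $(\rho_1\otimes\rho_2)(g)=\rho_1(g)\otimes\rho_2(g)$ (Kronecker product of matrices). *)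

(* Defs.v *)
From HB Require Import structures.
From mathcomp Require Import all_boot all_order all_algebra.
From mathcomp Require Import all_classical all_reals trigo.
From mathcomp Require Import complex mxtens ring lra.

Set Implicit Arguments.
Unset Strict Implicit.
Unset Printing Implicit Defensive.

Import Order.TTheory GRing.Theory Num.Theory.
Local Open Scope quotient_scope.
Local Open Scope ring_scope.

(* Groups given by generators and relations. A letter is a generator paired
   with a boolean that is true when the generator is inverted. *)

Definition word (X : Type) := seq (X * bool).

Definition gen {X : Type} (x : X) : X * bool := (x, false).
Definition genV {X : Type} (x : X) : X * bool := (x, true).

Section Presentation.
Variables (X : choiceType) (rel : word X -> word X -> Prop).

Inductive pres_eq : word X -> word X -> Prop :=
| pres_rel u v : rel u v -> pres_eq u v
| pres_cancel x b : pres_eq [:: (x, b); (x, ~~ b)] [::]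
| pres_cat u u' v v' : pres_eq u u' -> pres_eq v v' ->
    pres_eq (u ++ v) (u' ++ v')
| pres_refl u : pres_eq u u
| pres_sym u v : pres_eq u v -> pres_eq v u
| pres_trans u v w : pres_eq u v -> pres_eq v w -> pres_eq u w.

Definition pres_eqb (u v : word X) : bool := `[< pres_eq u v >].

Fact pres_eqb_refl : reflexive pres_eqb.
Proof. by move=> u; apply/asboolP; exact: pres_refl. Qed.

Fact pres_eqb_sym : symmetric pres_eqb.
Proof. by move=> u v; apply/asboolP/asboolP; exact: pres_sym. Qed.

Fact pres_eqb_trans : transitive pres_eqb.
Proof.
move=> v u w /asboolP uv /asboolP vw; apply/asboolP; exact: pres_trans uv vw.
Qed.

Canonical pres_equiv :=
  EquivRel pres_eqb pres_eqb_refl pres_eqb_sym pres_eqb_trans.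

Definition presented := {eq_quot pres_equiv}.
HB.instance Definition _ := Choice.on presented.

Definition pres_class (u : word X) : presented := \pi_({eq_quot pres_equiv}) u.
Definition pres_repr (p : presented) : word X :=
  repr (p : {eq_quot pres_equiv}).

Lemma pres_reprK p : pres_class (pres_repr p) = p.
Proof. exact: reprK. Qed.

Lemma pres_classP u v : pres_class u = pres_class v <-> pres_eq u v.
Proof.
by split=> [/eqmodP/asboolP // | uv]; apply/eqmodP/asboolP.
Qed.

Lemma pres_reprP u : pres_eq (pres_repr (pres_class u)) u.
Proof. by apply/pres_classP; rewrite pres_reprK. Qed.

Definition word_inv (u : word X) : word X := [seq (p.1, ~~ p.2) | p <- rev u].

Lemma word_mulVw u : pres_eq (word_inv u ++ u) [::].
Proof.
elim: u => [|[x b] u IHu]; first exact: pres_refl.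
rewrite /word_inv rev_cons map_rcons cat_rcons /=.
rewrite -[_ :: (x, b) :: u]/([:: (x, ~~ b); (x, b)] ++ u).
apply: pres_trans IHu; apply: pres_cat; first exact: pres_refl.
apply: (@pres_trans _ ([::] ++ u)); last exact: pres_refl.
apply: pres_cat; last exact: pres_refl.
by rewrite -{2}[b]negbK; exact: pres_cancel.
Qed.

Lemma word_invK : involutive word_inv.
Proof.
move=> u; rewrite /word_inv -map_rev revK -map_comp -[RHS]map_id.
by apply: eq_map => -[x b] /=; rewrite negbK.
Qed.

Lemma word_mulwV u : pres_eq (u ++ word_inv u) [::].
Proof. by rewrite -{1}[u]word_invK; exact: word_mulVw. Qed.

Definition pres_one : presented := pres_class [::].
Definition pres_mul (p q : presented) : presented :=
  pres_class (pres_repr p ++ pres_repr q).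
Definition pres_inv (p : presented) : presented :=
  pres_class (word_inv (pres_repr p)).

Fact pres_mulA : associative pres_mul.
Proof.
move=> p q r; apply/pres_classP.
apply: (@pres_trans _ (pres_repr p ++ (pres_repr q ++ pres_repr r))).
  by apply: pres_cat; [exact: pres_refl | exact: pres_reprP].
rewrite catA; apply: pres_cat; last exact: pres_refl.
by apply: pres_sym; exact: pres_reprP.
Qed.

Fact pres_mul1 : left_id pres_one pres_mul.
Proof.
move=> p; rewrite -[RHS]pres_reprK; apply/pres_classP.
rewrite -[X in pres_eq _ X]cat0s.
by apply: pres_cat; [exact: pres_reprP | exact: pres_refl].
Qed.

Fact pres_mulr1 : right_id pres_one pres_mul.
Proof.
move=> p; rewrite -[RHS]pres_reprK; apply/pres_classP.
rewrite -[X in pres_eq _ X]cats0.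
by apply: pres_cat; [exact: pres_refl | exact: pres_reprP].
Qed.

Fact pres_mulV : left_inverse pres_one pres_inv pres_mul.
Proof.
move=> p; apply/pres_classP; apply: pres_trans (word_mulVw (pres_repr p)).
by apply: pres_cat; [exact: pres_reprP | exact: pres_refl].
Qed.

Fact pres_mulrV : right_inverse pres_one pres_inv pres_mul.
Proof.
move=> p; apply/pres_classP; apply: pres_trans (word_mulwV (pres_repr p)).
by apply: pres_cat; [exact: pres_refl | exact: pres_reprP].
Qed.

HB.instance Definition _ := isGroup.Build presented
  pres_mulA pres_mul1 pres_mulr1 pres_mulV pres_mulrV.

Lemma pres_classM u v :
  pres_class (u ++ v) = (pres_class u * pres_class v)%g.
Proof.
by apply/pres_classP; apply: pres_cat; apply: pres_sym; exact: pres_reprP.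
Qed.

Definition pres_gen (x : X) : presented := pres_class [:: gen x].

Section Lift.
Variables (G : groupType) (f : X -> G).

Definition eval_word (u : word X) : G :=
  (\prod_(p <- u) (if p.2 then (f p.1)^-1 else f p.1))%g.

Lemma eval_word_cat u v :
  eval_word (u ++ v) = (eval_word u * eval_word v)%g.
Proof. by rewrite /eval_word big_cat. Qed.

Definition respects := forall u v, rel u v -> eval_word u = eval_word v.

Lemma eval_word_pres u v : respects -> pres_eq u v ->
  eval_word u = eval_word v.
Proof.
move=> fP; elim=> {u v} //.
- move=> x b; rewrite /eval_word !big_cons !big_nil mulg1.
  by case: b => /=; rewrite ?mulVg ?mulgV.
- by move=> u u' v v' _ IHu _ IHv; rewrite !eval_word_cat IHu IHv.
- by move=> u v w _ -> _ ->.
Qed.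

Definition pres_lift (fP : respects) (p : presented) : G :=
  eval_word (pres_repr p).

Lemma pres_lift_class fP u : pres_lift fP (pres_class u) = eval_word u.
Proof. by apply: (eval_word_pres fP); exact: pres_reprP. Qed.

Fact pres_liftM fP : {morph pres_lift fP : p q / (p * q)%g}.
Proof.
move=> p q; rewrite -[p]pres_reprK -[q]pres_reprK -pres_classM.
by rewrite !pres_lift_class eval_word_cat.
Qed.

HB.instance Definition _ fP :=
  isMultiplicative.Build presented G (pres_lift fP) (pres_liftM fP).

Lemma pres_lift_gen fP x : pres_lift fP (pres_gen x) = f x.
Proof. by rewrite pres_lift_class /eval_word big_seq1. Qed.

End Lift.
End Presentation.

(* The generator sigma_(i+1) is Some i, for i : 'I_n, and tau is None;
   ordS i is the cyclic successor of i. *)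
Section NecklaceBraid.
Variable n : nat.

Notation sigma i := (gen (Some i)).
Notation tau := (gen None).
Notation tauV := (genV None).

Inductive necklace_rel :
  word (option 'I_n) -> word (option 'I_n) -> Prop :=
| necklace_braid i :
    necklace_rel [:: sigma i; sigma (ordS i); sigma i]
                 [:: sigma (ordS i); sigma i; sigma (ordS i)]
| necklace_comm i j : i != ordS j -> j != ordS i ->
    necklace_rel [:: sigma i; sigma j] [:: sigma j; sigma i]
| necklace_conj i :
    necklace_rel [:: tau; sigma i; tauV] [:: sigma (ordS i)]
| necklace_order : necklace_rel (nseq (2 * n) tau) [::].

Definition necklace_braid_group : groupType := presented necklace_rel.

End NecklaceBraid.

Section GeneralLinear.
Variables (F : fieldType) (n : nat).

Record GL := MkGL { GLval :> 'M[F]_n; GL_unit : GLval \in unitmx }.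

HB.instance Definition _ := [isSub for GLval].
HB.instance Definition _ := [Choice of GL by <:].

Definition GL_one : GL := MkGL (unitmx1 F n).

Fact GL_mul_unit (A B : GL) : GLval A *m GLval B \in unitmx.
Proof. by rewrite unitmx_mul !GL_unit. Qed.
Definition GL_mul (A B : GL) : GL := MkGL (GL_mul_unit A B).

Fact GL_inv_unit (A : GL) : invmx A \in unitmx.
Proof. by rewrite unitmx_inv GL_unit. Qed.
Definition GL_inv (A : GL) : GL := MkGL (GL_inv_unit A).

Fact GL_mulA : associative GL_mul.
Proof. by move=> A B C; apply/val_inj; rewrite /= mulmxA. Qed.
Fact GL_mul1 : left_id GL_one GL_mul.
Proof. by move=> A; apply/val_inj; rewrite /= mul1mx. Qed.
Fact GL_mulr1 : right_id GL_one GL_mul.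
Proof. by move=> A; apply/val_inj; rewrite /= mulmx1. Qed.
Fact GL_mulV : left_inverse GL_one GL_inv GL_mul.
Proof. by move=> A; apply/val_inj; rewrite /= mulVmx ?GL_unit. Qed.
Fact GL_mulrV : right_inverse GL_one GL_inv GL_mul.
Proof. by move=> A; apply/val_inj; rewrite /= mulmxV ?GL_unit. Qed.

HB.instance Definition _ :=
  isGroup.Build GL GL_mulA GL_mul1 GL_mulr1 GL_mulV GL_mulrV.

Lemma GLvalM (A B : GL) : GLval (A * B)%g = A *m B. Proof. by []. Qed.
Lemma GLvalV (A : GL) : GLval (A^-1)%g = invmx A. Proof. by []. Qed.
Lemma GLval1 : GLval 1%g = 1%:M. Proof. by []. Qed.

End GeneralLinear.

(* A multiplicative map between groups preserves 1 and inverses. *)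
Definition representation (G : groupType) (F : fieldType) (n : nat) :=
  {multiplicative G -> GL F n}.

Definition irreducible (G : groupType) (F : fieldType) (n : nat)
    (rho : representation G F n) : Prop :=
  (0 < n)%N /\
  forall U : {vspace 'cV[F]_n},
    (forall g v, v \in U -> GLval (rho g) *m v \in U) ->
    U = 0%VS \/ U = fullv.

Section Tensor.
Variables (G : groupType) (F : fieldType) (m n : nat).

Lemma tensmx1 : (1%:M : 'M[F]_m) *t (1%:M : 'M[F]_n) = 1%:M.
Proof.
apply/matrixP => i j; case: (mxtens_indexP i) => i0 i1.
case: (mxtens_indexP j) => j0 j1; rewrite tensmxE !mxE -natrM mulnb.
by rewrite (can_eq (@mxtens_indexK _ _)) xpair_eqE.
Qed.

Fact tens_GL_unit (A : GL F m) (B : GL F n) : A *t B \in unitmx.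
Proof.
have /mulmx1_unit[//] : (A *t B) *m (invmx A *t invmx B) = 1%:M.
by rewrite tensmx_mul !mulmxV ?GL_unit // tensmx1.
Qed.

Definition tens_GL (A : GL F m) (B : GL F n) : GL F (m * n) :=
  MkGL (tens_GL_unit A B).

Variables (rho1 : representation G F m) (rho2 : representation G F n).

Definition tensor_fun (g : G) : GL F (m * n) := tens_GL (rho1 g) (rho2 g).

Fact tensor_funM : {morph tensor_fun : g h / (g * h)%g}.
Proof.
by move=> g h; apply/val_inj; rewrite /= !gmulfM /= tensmx_mul.
Qed.

HB.instance Definition _ := isMultiplicative.Build G (GL F (m * n))
  tensor_fun tensor_funM.

Definition tensor_rep : representation G F (m * n) := tensor_fun.

End Tensor.

Section Rho.
Variables (F : fieldType) (n : nat).

Definition mx2 (a b c d : F) : 'M[F]_2 :=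
  \matrix_(i, j) (if i == 0 then if j == 0 then a else b
                  else if j == 0 then c else d).

Variables (T t a c d : F).

(* Some i stands for sigma_(i+1), so the exponents i.+1 - 1 and 1 - i.+1
   become i and - i. *)
Definition rho_mx (x : option 'I_n) : 'M[F]_2 :=
  match x with
  | Some i => mx2 a (T ^+ i) (c * T ^- i) d
  | None => mx2 (T * t) 0 0 t
  end.

(* The parameters for which rho_mx extends to the necklace braid group. *)
Record rho_admissible : Prop := RhoAdmissible {
  rho_unit : forall x, rho_mx x \in unitmx;
  rho_respects :
    respects (@necklace_rel n) (fun x => MkGL (rho_unit x))
}.

Definition rho (adm : rho_admissible) :
    representation (necklace_braid_group n) F 2 :=
  pres_lift (rho_respects adm).

Lemma rho_gen adm x : GLval (rho adm (pres_gen _ x)) = rho_mx x.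
Proof. by rewrite [rho adm _]pres_lift_gen. Qed.

End Rho.

Section Mx2.
Variable F : fieldType.
Implicit Types a b c d : F.

Lemma mx2M a b c d a' b' c' d' :
  mx2 a b c d *m mx2 a' b' c' d' =
  mx2 (a * a' + b * c') (a * b' + b * d') (c * a' + d * c') (c * b' + d * d').
Proof.
apply/matrixP => i j; rewrite !mxE !big_ord_recl big_ord0 addr0 !mxE /=.
by case: (i == 0); case: (j == 0).
Qed.

Lemma mx2_1 : mx2 1 0 0 1 = 1%:M :> 'M[F]_2.
Proof.
apply/matrixP => i j; rewrite !mxE.
by case: i => [[|[|//]] ?]; case: j => [[|[|//]] ?].
Qed.

Lemma mx2_unit a b c d : a * d - b * c != 0 -> mx2 a b c d \in unitmx.
Proof.
move=> D0; set D := _ - _ in D0.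
have /mulmx1_unit[//] :
  mx2 a b c d *m mx2 (d / D) (- b / D) (- c / D) (a / D) = 1%:M.
by rewrite mx2M -mx2_1; congr mx2; rewrite /D; field.
Qed.

End Mx2.


Lemma rho_admissible3 (F : fieldType) (T t w c d : F) :
  T ^+ 3 = 1 -> t ^+ 6 = 1 -> w ^+ 2 - w + 1 = 0 -> c != w * d ^+ 2 ->
  rho_admissible 3 T t (w * d) c d.
Proof.
move=> T3 t6 w1 cNwd.
have T0 : T != 0.
  by apply: contra_eq_neq T3 => ->; rewrite expr0n /= eq_sym oner_eq0.
have t0 : t != 0.
  by apply: contra_eq_neq t6 => ->; rewrite expr0n /= eq_sym oner_eq0.
have unitP x : rho_mx (n := 3) T t (w * d) c d x \in unitmx.
  case: x => [i|]; apply: mx2_unit; last by rewrite mulr0 subr0 !mulf_neq0.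
  rewrite mulrCA mulfV ?expf_neq0 // mulr1 -mulrA -expr2 subr_eq0.
  by rewrite eq_sym.
exists unitP => u v.
have TS (i : 'I_3) : T ^+ ordS i = T * T ^+ i.
  by case: i => [[|[|[|//]]] ?]; rewrite -exprS //= T3.
have x0 (i : 'I_3) : T ^+ i != 0 by rewrite expf_neq0.
case=> {u v} [i | i j ij ji | i |].
- apply/val_inj.
  rewrite /eval_word !big_cons big_nil /= !mulmx1 !mx2M TS.
  move: (T ^+ i) (x0 i) => x {}x0.
  congr mx2; first by field; rewrite ?x0 ?T0.
  + apply/eqP; rewrite -subr_eq0; apply/eqP.
    transitivity (x * ((1 - T) * d ^+ 2 * (w ^+ 2 - w + 1)
                       + c / T * (1 - T ^+ 3))).
      by field; rewrite ?x0 ?T0.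
    by rewrite w1 T3 subrr !mulr0 addr0 mulr0.
  + apply/eqP; rewrite -subr_eq0; apply/eqP.
    transitivity (c / x * ((1 - T^-1) * d ^+ 2 * (w ^+ 2 - w + 1)
                       + c / T ^+ 2 * (T ^+ 3 - 1))).
      by field; rewrite ?x0 ?T0.
    by rewrite w1 T3 subrr !mulr0 addr0 mulr0.
  + by field; rewrite ?x0 ?T0.
- suff -> : i = j by [].
  by apply/val_inj; move: i j ij ji => [[|[|[|//]]] ?] [[|[|[|//]]] ?].
- rewrite /eval_word !big_cons big_nil /= !mulg1 mulgA.
  apply: (canLR (mulgK _)); apply/val_inj; rewrite /= !mx2M TS.
  move: (T ^+ i) (x0 i) => x {}x0.
  by congr mx2; field; rewrite ?x0 ?T0.
- apply/val_inj.
  rewrite /eval_word !big_cons big_nil /= !mulmxA !mx2M mulmx1 -mx2_1.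
  congr mx2; rewrite !(mulr0, mul0r, addr0, add0r) //.
  + by rewrite -[RHS](mulr1 1) -{1}(expr1n _ 2) -{1}T3 -t6; ring.
  + by rewrite -[RHS]t6; ring.
Qed.

Section Complex.
Variable R : realType.

(* Euler's formula for e^(i theta) *)
Definition expi (theta : R) : R[i] := (cos theta +i* sin theta)%C.

Lemma expiD x y : expi (x + y) = expi x * expi y.
Proof.
rewrite /expi cosD sinD; apply/eqP; rewrite eq_complex /=.
by rewrite eqxx /= addrC.
Qed.

Lemma expi0 : expi 0 = 1.
Proof. by rewrite /expi cos0 sin0. Qed.

Lemma expiX x n : expi x ^+ n = expi (x *+ n).
Proof. by elim: n => [|n IHn]; rewrite ?expi0 // exprS IHn mulrS expiD. Qed.

Lemma expi_cube_root (T : R[i]) :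
  T = expi (2 * pi / 3) \/ T = expi (- (2 * pi / 3)) -> T ^+ 3 = 1.
Proof.
have third (x : R) : x / 3 *+ 3 = x by rewrite -mulr_natr divfK // pnatr_eq0.
case=> ->; rewrite expiX ?mulNrn third.
  by rewrite /expi mulr_natl cos2pi sin2pi.
by rewrite /expi cosN sinN mulr_natl cos2pi sin2pi oppr0.
Qed.

Lemma expi_sixth_root (w : R[i]) :
  w = expi (pi / 3) \/ w = expi (- (pi / 3)) -> w ^+ 2 - w + 1 = 0.
Proof.
move=> wE.
have s0 : 0 < sin (pi / 3 : R).
  by apply: sin_gt0_pi; have := pi_gt0 R; move: (pi : R) => p p0; apply/andP; split; lra.
have third (x : R) : x / 3 *+ 3 = x by rewrite -mulr_natr divfK // pnatr_eq0.
have w3 : w ^+ 3 = -1.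
  case: wE => ->; rewrite expiX ?mulNrn third /expi ?cosN ?sinN cospi sinpi;
    by apply/eqP; rewrite eq_complex /= !oppr0 !eqxx.
have wN1 : w + 1 != 0.
  rewrite eq_complex /= negb_and orbC; case: wE => -> /=.
    by rewrite addr0 gt_eqF.
  by rewrite addr0 sinN oppr_eq0 gt_eqF.
apply: (mulfI wN1); rewrite mulr0.
by transitivity (w ^+ 3 + 1); [ring | rewrite w3 addNr].
Qed.

Lemma rho3_admissible (T t w c d : R[i]) :
  t ^+ 6 = 1 ->
  T = expi (2 * pi / 3) \/ T = expi (- (2 * pi / 3)) ->
  w = expi (pi / 3) \/ w = expi (- (pi / 3)) ->
  c != w * d ^+ 2 ->
  rho_admissible 3 T t (w * d) c d.
Proof.
move=> t6 /expi_cube_root T3 /expi_sixth_root w1 cNwd.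
exact: rho_admissible3.
Qed.

End Complex.

(* Main.v *)
(** Up to a scalar, tau acts on C^2 (x) C^2 diagonally with spectrum
    {T1 T2, T1, T2, 1}, of which exactly two members coincide; let f1, f4 span
    the two-dimensional eigenspace and f2, f3 the two others.  A stable subspace
    U splits along these eigenspaces.  Either U contains f2 or f3, hence both,
    as sigma_1 has no zero off-diagonal entry, hence also the components of
    sigma_1 f2 and sigma_1 f3 in <f1, f4>; or U and sigma_1 U lie in <f1, f4>.
    In both cases a determinant decides, which is up to a nonzero factor
    [w1 d1^2 c2 - w2 d2^2 c1]; when it vanishes, applying sigma_1 once more
    yields a second determinant, a multiple of [1 - w1 w2] when T1 T2 = 1 and of
    [w2 - w1] when T1 = T2.  When both vanish, the two components are collinear
    and span with f2 and f3 a stable subspace of dimension 3. *)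

Require Import Defs.
From mathcomp Require Import all_boot all_order all_algebra.
From mathcomp Require Import all_reals trigo complex.
From mathcomp Require Import mxtens ring lra.

Set Implicit Arguments.
Unset Strict Implicit.

Import Order.TTheory GRing.Theory Num.Theory.
Local Open Scope ring_scope.

(** * Induction on presented groups, and generators of the necklace braid group *)

Lemma pres_class_genV (X : choiceType) (rel : word X -> word X -> Prop) x :
  pres_class rel [:: genV x] = (pres_gen rel x)^-1%g.
Proof.
apply: (mulgI (pres_gen rel x)); rewrite mulgV -pres_classM.
by apply/pres_classP; apply: pres_cancel.
Qed.

Lemma presented_ind (X : choiceType) (rel : word X -> word X -> Prop)
    (P : presented rel -> Prop) :
  P 1%g -> (forall g h, P g -> P h -> P (g * h)%g) ->
  (forall g, P g -> P g^-1%g) -> (forall x, P (pres_gen rel x)) ->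
  forall g, P g.
Proof.
move=> P1 PM PV Pgen g; rewrite -[g]pres_reprK.
elim: (pres_repr g) => [|[x b] u IHu]; first exact: P1.
rewrite -cat1s pres_classM; apply: PM => //; case: b; last exact: Pgen.
by rewrite pres_class_genV; apply: PV; apply: Pgen.
Qed.

Lemma necklace_sigmaS (n : nat) (i : 'I_n) :
  pres_gen (@necklace_rel n) (Some (ordS i)) =
  (pres_gen _ None * (pres_gen _ (Some i) * (pres_gen _ None)^-1))%g.
Proof.
rewrite -pres_class_genV -[X in (_ * X)%g]pres_classM -pres_classM.
apply/pres_classP/pres_sym/pres_rel.
exact: necklace_conj.
Qed.

(** Conjugation by tau carries each sigma_i to the next one, so tau and sigma_1 already generate the
    group. *)
Lemma necklace_braid_group_ind (n : nat)
    (P : necklace_braid_group n.+1 -> Prop) :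
  P 1%g -> (forall g h, P g -> P h -> P (g * h)%g) ->
  (forall g, P g -> P g^-1%g) ->
  P (pres_gen _ None) -> P (pres_gen _ (Some ord0)) -> forall g, P g.
Proof.
move=> P1 PM PV Ptau Psigma; apply: presented_ind => // -[i|//].
case: i => i; elim: i => [|i IHi] ilt.
  by rewrite (_ : Ordinal ilt = ord0) //; apply/val_inj.
have {}IHi := IHi (ltnW ilt).
rewrite (_ : Ordinal ilt = ordS (Ordinal (ltnW ilt))); last first.
  by apply/val_inj; rewrite /= modn_small.
by rewrite necklace_sigmaS; apply: (PM) => //; apply: (PM) => //; apply: (PV).
Qed.

Lemma multiplicative1 (G H : groupType) (f : {multiplicative G -> H}) :
  f 1%g = 1%g.
Proof. by apply: (mulgI (f 1%g)); rewrite -gmulfM !mulg1. Qed.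

Lemma multiplicativeV (G H : groupType) (f : {multiplicative G -> H}) g :
  f g^-1%g = (f g)^-1%g.
Proof.
by apply: (mulgI (f g)); rewrite -gmulfM !mulgV multiplicative1.
Qed.

(** * Subspaces stable under matrices *)

Section Stable.
Variables (F : fieldType) (n : nat).
Implicit Types (A B : 'M[F]_n) (U : {vspace 'cV[F]_n}).

Definition mx_stable U A := forall v, v \in U -> A *m v \in U.

Lemma mx_stable_mul U A B :
  mx_stable U A -> mx_stable U B -> mx_stable U (A *m B).
Proof. by move=> sA sB v Uv; rewrite -mulmxA; apply/sA/sB. Qed.

Lemma mx_stable_span (X : seq 'cV[F]_n) A :
  (forall v, v \in X -> A *m v \in <<X>>%VS) -> mx_stable <<X>>%VS A.
Proof.
move=> sX v Xv; rewrite -[A *m v](lfunE (mulmx A)).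
have : linfun (mulmx A) v \in (linfun (mulmx A) @: <<X>>)%VS by exact: memv_img.
apply/subvP; rewrite limg_span; apply/span_subvP => _ /mapP[u Xu ->].
by rewrite lfunE; apply: sX.
Qed.

(** [A] is injective on [U], hence by dimension maps [U] onto itself; each vector of [U] is then
    [A *m u] with [u] in [U]. *)
Lemma mx_stable_invmx U A :
  A \in unitmx -> mx_stable U A -> mx_stable U (invmx A).
Proof.
move=> unitA sA v Uv.
have: (linfun (mulmx A) @: U == U)%VS.
  rewrite eqEdim; apply/andP; split.
    by apply/subvP => _ /memv_imgP[u Uu ->]; rewrite lfunE; apply: sA.
  rewrite limg_dim_eq //; apply/eqP; rewrite -subv0; apply/subvP => u.
  rewrite memv_cap memv_ker lfunE /= => /andP[_ /eqP Au0].
  by rewrite -[u](mulKmx unitA) Au0 mulmx0 mem0v.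
move=> /eqP UE; move: Uv; rewrite -{1}UE => /memv_imgP[u Uu ->].
by rewrite lfunE /= mulKmx.
Qed.

Lemma irreducible_necklaceP (m : nat)
    (r : representation (necklace_braid_group m.+1) F n) :
  irreducible r <->
  (0 < n)%N /\ forall U, mx_stable U (Defs.GLval (r (pres_gen _ None))) ->
    mx_stable U (Defs.GLval (r (pres_gen _ (Some ord0)))) ->
    U = 0%VS \/ U = fullv.
Proof.
split=> -[n0 irr]; split=> // U; last first.
  by move=> sU; apply: irr => v Uv; apply: sU.
move=> sT sS; apply: irr.
apply: necklace_braid_group_ind => //.
- by move=> v Uv; rewrite multiplicative1 GLval1 mul1mx.
- by move=> g h sg sh; rewrite gmulfM GLvalM; apply: mx_stable_mul.
- by move=> g sg; rewrite multiplicativeV GLvalV;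
  apply: mx_stable_invmx => //; exact: Defs.GL_unit.
Qed.

End Stable.

(** * Stable subspaces for a pair of Kronecker products *)

Section TensorProduct.

(* [u *t v] has [1 * 1] columns, which unification does not identify with 1. *)
Definition tens_cv (F : fieldType) (n1 n2 : nat)
    (u : 'cV[F]_n1) (v : 'cV[F]_n2) : 'cV[F]_(n1 * n2) := u *t v.

Lemma mul_tens_cv (F : fieldType) (n1 n2 : nat)
    (A : 'M[F]_n1) (B : 'M[F]_n2) u v :
  (A *t B) *m tens_cv u v = tens_cv (A *m u) (B *m v).
Proof. exact: (tensmx_mul A B u v). Qed.

Variables (F : fieldType) (n1 n2 : nat).
Variables (A1 D1 : 'M[F]_n1) (A2 D2 : 'M[F]_n2).
Variables (u1 u2 : 'cV[F]_n1) (v1 v2 : 'cV[F]_n2).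
Variables (a1 b1 c1 d1 a2 b2 c2 d2 p1 p2 q1 q2 : F).

Hypotheses (A1u1 : A1 *m u1 = a1 *: u1 + c1 *: u2)
           (A1u2 : A1 *m u2 = b1 *: u1 + d1 *: u2).
Hypotheses (A2v1 : A2 *m v1 = a2 *: v1 + c2 *: v2)
           (A2v2 : A2 *m v2 = b2 *: v1 + d2 *: v2).
Hypotheses (D1u1 : D1 *m u1 = p1 *: u1) (D1u2 : D1 *m u2 = p2 *: u2).
Hypotheses (D2v1 : D2 *m v1 = q1 *: v1) (D2v2 : D2 *m v2 = q2 *: v2).
Hypothesis pq : p1 * q1 = p2 * q2.

Let A : 'M[F]_(n1 * n2) := A1 *t A2.
Let D : 'M[F]_(n1 * n2) := D1 *t D2.

(** The coordinates refer to f1, f2, f3, f4 in this order. By [pq], f1 and f4 share the eigenvalue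
    [m] of [D]; f2 and f3 have [m2] and [m3]. *)
Definition tens_comb x y z w : 'cV[F]_(n1 * n2) :=
  x *: tens_cv u1 v1 + y *: tens_cv u1 v2
  + z *: tens_cv u2 v1 + w *: tens_cv u2 v2.
Local Notation comb := tens_comb.
Local Notation m := (p1 * q1).
Local Notation m2 := (p1 * q2).
Local Notation m3 := (p2 * q1).

Let Acomb x y z w : A *m comb x y z w = comb
  (x * (a1 * a2) + y * (a1 * b2) + z * (b1 * a2) + w * (b1 * b2))
  (x * (a1 * c2) + y * (a1 * d2) + z * (b1 * c2) + w * (b1 * d2))
  (x * (c1 * a2) + y * (c1 * b2) + z * (d1 * a2) + w * (d1 * b2))
  (x * (c1 * c2) + y * (c1 * d2) + z * (d1 * c2) + w * (d1 * d2)).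
Proof.
rewrite /comb /A /D !mulmxDr -!scalemxAr !mul_tens_cv A1u1 A1u2 A2v1 A2v2.
by apply/matrixP => i j; rewrite !mxE; ring.
Qed.

Let Dcomb x y z w :
  D *m comb x y z w = comb (m * x) (m2 * y) (m3 * z) (m * w).
Proof.
rewrite /comb /A /D !mulmxDr -!scalemxAr !mul_tens_cv D1u1 D1u2 D2v1 D2v2.
by apply/matrixP => i j; rewrite !mxE; ring: pq.
Qed.

Let combZ k x y z w : k *: comb x y z w = comb (k * x) (k * y) (k * z) (k * w).
Proof. by apply/matrixP => i j; rewrite !mxE; ring. Qed.

Let combD x y z w x' y' z' w' :
  comb x y z w + comb x' y' z' w' = comb (x + x') (y + y') (z + z') (w + w').
Proof. by apply/matrixP => i j; rewrite !mxE; ring. Qed.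

(* With P the projection onto the span of [tens_cv u1 v1] and [tens_cv u2 v2],
   [tens_det] is the determinant of P A f and P A g for f := [tens_cv u1 v2] and
   g := [tens_cv u2 v1], and [b2 * c1 * tens_det2] that of P A f and
   P A (P A f). *)
Definition tens_det : F := a1 * d1 * b2 * c2 - b1 * c1 * a2 * d2.
Definition tens_det2 : F :=
  d2 ^+ 2 * (a1 * d1 - b1 * c1) - a1 ^+ 2 * (a2 * d2 - b2 * c2).

Hypotheses (b1_neq0 : b1 != 0) (c1_neq0 : c1 != 0).
Hypotheses (b2_neq0 : b2 != 0) (c2_neq0 : c2 != 0).

(** * One nonzero determinant excludes proper nonzero stable subspaces *)

Section Irreducible.
Hypotheses (mm2 : m != m2) (mm3 : m != m3) (m23 : m2 != m3).
Hypothesis comb_span : forall v, exists x y z w, v = comb x y z w.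
Hypothesis det_neq0 : (tens_det != 0) || (tens_det2 != 0).
Variable U : {vspace 'cV[F]_(n1 * n2)}.
Hypotheses (UA : mx_stable U A) (UD : mx_stable U D).

Let comb_lin k x y z w l x' y' z' w' :
  comb x y z w \in U -> comb x' y' z' w' \in U ->
  comb (k * x + l * x') (k * y + l * y') (k * z + l * z') (k * w + l * w') \in U.
Proof. by move=> U1 U2; rewrite -combD -!combZ memvD ?memvZ. Qed.

Let combUA x y z w : comb x y z w \in U -> comb
  (x * (a1 * a2) + y * (a1 * b2) + z * (b1 * a2) + w * (b1 * b2))
  (x * (a1 * c2) + y * (a1 * d2) + z * (b1 * c2) + w * (b1 * d2))
  (x * (c1 * a2) + y * (c1 * b2) + z * (d1 * a2) + w * (d1 * b2))
  (x * (c1 * c2) + y * (c1 * d2) + z * (d1 * c2) + w * (d1 * d2)) \in U.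
Proof. by rewrite -Acomb; apply: UA. Qed.

Let combUD x y z w :
  comb x y z w \in U -> comb (m * x) (m2 * y) (m3 * z) (m * w) \in U.
Proof. by rewrite -Dcomb; apply: UD. Qed.

Let combU_eq x y z w x' y' z' w' : comb x y z w \in U ->
  x = x' -> y = y' -> z = z' -> w = w' -> comb x' y' z' w' \in U.
Proof. by move=> Uv <- <- <- <-. Qed.

(** The Lagrange polynomial [(D - m)(D - m3) / ((m2 - m)(m2 - m3))] kills f1, f3, f4 and fixes
    f2. *)
Let combU2 x y z w : comb x y z w \in U -> comb 0 y 0 0 \in U.
Proof.
move=> Uv; have UDv := combUD Uv.
have Uv' := comb_lin (- m) 1 Uv UDv.
have UDv' := combUD Uv'.
have m2m : m2 - m != 0 by rewrite subr_eq0 eq_sym.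
have m2m3 : m2 - m3 != 0 by rewrite subr_eq0.
have := comb_lin (- m3 / ((m2 - m) * (m2 - m3)))
  (1 / ((m2 - m) * (m2 - m3))) Uv' UDv'.
by move=> /combU_eq; apply; field; rewrite ?m2m ?m2m3.
Qed.

Let combU3 x y z w : comb x y z w \in U -> comb 0 0 z 0 \in U.
Proof.
move=> Uv; have UDv := combUD Uv.
have Uv' := comb_lin (- m) 1 Uv UDv.
have UDv' := combUD Uv'.
have m3m : m3 - m != 0 by rewrite subr_eq0 eq_sym.
have m3m2 : m3 - m2 != 0 by rewrite subr_eq0 eq_sym.
have := comb_lin (- m2 / ((m3 - m) * (m3 - m2)))
  (1 / ((m3 - m) * (m3 - m2))) Uv' UDv'.
by move=> /combU_eq; apply; field; rewrite ?m3m ?m3m2.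
Qed.

Let combU14 x y z w : comb x y z w \in U -> comb x 0 0 w \in U.
Proof.
move=> Uv; have := comb_lin 1 (- 1) Uv
  (comb_lin 1 1 (combU2 Uv) (combU3 Uv)).
by move=> /combU_eq; apply; ring.
Qed.

Let full_of_pair x w x' w' :
  comb 0 1 0 0 \in U -> comb 0 0 1 0 \in U ->
  comb x 0 0 w \in U -> comb x' 0 0 w' \in U ->
  x * w' - w * x' != 0 -> U = fullv.
Proof.
move=> U2 U3 Uv Uv' e0; apply/eqP; rewrite eqEsubv subvf /=.
apply/subvP => v _; have [p [q [r [s ->]]]] := comb_span v.
(* Cramer's rule gives the coefficients that produce the f1 and f4 coordinates [p] and [s]. *)
have := comb_lin 1 1 (comb_lin q r U2 U3) (comb_lin
  ((p * w' - s * x') / (x * w' - w * x'))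
  ((s * x - p * w) / (x * w' - w * x')) Uv Uv').
by move=> /combU_eq; apply; field.
Qed.

Let full_of_f23 :
  comb 0 1 0 0 \in U -> comb 0 0 1 0 \in U -> U = fullv.
Proof.
move=> U2 U3.
(* [U14] and [U14'] hold the f1, f4 parts of [A f2] and [A f3], whose determinant is [tens_det]. *)
have := combU14 (combUA U2); have := combU14 (combUA U3).
rewrite !(mul0r, mul1r, addr0, add0r) => U14' U14.
have [d0|d0] := eqVneq tens_det 0; last first.
  apply: (full_of_pair U2 U3 U14 U14'); apply: contraNneq d0 => <-.
  by rewrite /tens_det; apply/eqP; ring.
move: det_neq0; rewrite d0 eqxx /= => e0.
have := combU14 (combUA U14) => U14''.
apply: (full_of_pair U2 U3 U14 U14'').
rewrite (_ : _ - _ = b2 * c1 * tens_det2); first by rewrite !mulf_neq0.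
by rewrite /tens_det2; ring.
Qed.

(** The f3 coordinate of [A f2] is [c1 * b2], which is nonzero, so f3 can be isolated and
    rescaled. *)
Let full_of_f2 : comb 0 1 0 0 \in U -> U = fullv.
Proof.
move=> U2; apply: full_of_f23 => //.
have := combU3 (combUA U2) => U3.
have := comb_lin (1 / (c1 * b2)) 0 U3 U3.
by move=> /combU_eq; apply; field; rewrite b2_neq0.
Qed.

Let full_of_f3 : comb 0 0 1 0 \in U -> U = fullv.
Proof.
move=> U3; apply: full_of_f2 => //.
have := combU2 (combUA U3) => U2.
have := comb_lin (1 / (b1 * c2)) 0 U2 U2.
by move=> /combU_eq; apply; field; rewrite c2_neq0.
Qed.

Lemma tens_stable_trivial : U = 0%VS \/ U = fullv.
Proof.
have [->|U0] := eqVneq U 0%VS; [by left | right].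
apply/eqP; apply: contraNT U0 => Ufull.
(* A nonzero f2 or f3 coordinate could be isolated and rescaled to put f2 or f3 in [U], forcing [U]
   to be full. *)
have no_f2 x y z w : comb x y z w \in U -> y = 0.
  move=> /combU2 U2; apply: contraNeq Ufull => y0; apply/eqP/full_of_f2.
  have := comb_lin (1 / y) 0 U2 U2.
  by move=> /combU_eq; apply; field.
have no_f3 x y z w : comb x y z w \in U -> z = 0.
  move=> /combU3 U3; apply: contraNeq Ufull => z0; apply/eqP/full_of_f3.
  have := comb_lin (1 / z) 0 U3 U3.
  by move=> /combU_eq; apply; field.
rewrite -subv0; apply/subvP => v.
have [x [y [z [w ->]]]] := comb_span v => Uv.
have y0 := no_f2 _ _ _ _ Uv; have z0 := no_f3 _ _ _ _ Uv.
rewrite {}y0 {}z0 in Uv *.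
(* Applied to [A v] and [A (A v)], this yields linear equations in [x] and [w]: [e2], [e3] have
   determinant [tens_det], and [e2], [e4] have determinant [b1 * c2 * tens_det2]. Cramer's rule is
   applied to whichever pair is nondegenerate. *)
have UAv := combUA Uv; have UAAv := combUA UAv.
have e2 := no_f2 _ _ _ _ UAv; have e3 := no_f3 _ _ _ _ UAv.
have e4 := no_f2 _ _ _ _ UAAv.
rewrite e2 e3 in e4; rewrite !(mul0r, addr0, add0r) in e2 e3 e4.
suff [-> ->] : x = 0 /\ w = 0 by rewrite /comb !scale0r !addr0 mem0v.
have [d0|d0] := eqVneq tens_det 0; last first.
  split; apply: (mulfI d0); rewrite mulr0 /tens_det.
  - transitivity ((x * (a1 * c2) + w * (b1 * d2)) * (d1 * b2)
      - (x * (c1 * a2) + w * (d1 * b2)) * (b1 * d2)); first by ring.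
    by rewrite e2 e3 !mul0r subr0.
  - transitivity ((x * (c1 * a2) + w * (d1 * b2)) * (a1 * c2)
      - (x * (a1 * c2) + w * (b1 * d2)) * (c1 * a2)); first by ring.
    by rewrite e2 e3 !mul0r subr0.
move: det_neq0; rewrite d0 eqxx /= => e0.
have k0 : b1 * c2 * tens_det2 != 0 by rewrite !mulf_neq0.
set x' := x * (a1 * a2) + w * (b1 * b2) in e4.
set w' := x * (c1 * c2) + w * (d1 * d2) in e4.
split; apply: (mulfI k0); rewrite mulr0 /tens_det2.
- transitivity ((x * (a1 * c2) + w * (b1 * d2))
      * (a1 * b1 * b2 * c2 + b1 * d1 * d2 ^+ 2)
    - (x' * (a1 * c2) + w' * (b1 * d2)) * (b1 * d2));
    first by rewrite /x' /w'; ring.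
  by rewrite e2 e4 !mul0r subr0.
- transitivity ((x' * (a1 * c2) + w' * (b1 * d2)) * (a1 * c2)
    - (x * (a1 * c2) + w * (b1 * d2))
      * (a1 ^+ 2 * a2 * c2 + b1 * c1 * c2 * d2));
    first by rewrite /x' /w'; ring.
  by rewrite e2 e4 !mul0r subr0.
Qed.

End Irreducible.

(** * A proper nonzero stable subspace when both determinants vanish *)

Section Reducible.
Local Notation f2 := (tens_cv u1 v2).
Local Notation f3 := (tens_cv u2 v1).
Hypotheses (a1_neq0 : a1 != 0).
Hypotheses (det_eq0 : tens_det = 0) (det2_eq0 : tens_det2 = 0) (f2_neq0 : f2 != 0).
Hypothesis n_gt3 : (3 < n1 * n2)%N.

Lemma tens_stable_nontrivial : exists U : {vspace 'cV[F]_(n1 * n2)},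
  [/\ mx_stable U A, mx_stable U D, U <> 0%VS & U <> fullv].
Proof.
(* [g] is the f1, f4 component of [A f2]. *)
pose g := comb (a1 * b2) 0 0 (c1 * d2).
exists <<[:: f2; f3; g]>>%VS.
have U2 : f2 \in <<[:: f2; f3; g]>>%VS by rewrite memv_span ?inE ?eqxx.
have U3 : f3 \in <<[:: f2; f3; g]>>%VS by rewrite memv_span ?inE ?eqxx ?orbT.
have Ug : g \in <<[:: f2; f3; g]>>%VS by rewrite memv_span ?inE ?eqxx ?orbT.
(* The f2 and f3 coordinates are free; only the f1, f4 part must be a multiple of [g]. *)
have Ucomb k y z x w : x = k * (a1 * b2) -> w = k * (c1 * d2) ->
    comb x y z w \in <<[:: f2; f3; g]>>%VS.
  move=> -> ->; suff -> : comb (k * (a1 * b2)) y z (k * (c1 * d2)) =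
      y *: f2 + z *: f3 + k *: g by rewrite !memvD ?memvZ.
  by apply/matrixP => i j; rewrite !mxE; ring.
have f2E : f2 = comb 0 1 0 0.
  by rewrite /comb !scale0r scale1r add0r !addr0.
have f3E : f3 = comb 0 0 1 0.
  by rewrite /comb !scale0r scale1r !add0r addr0.
split.
- apply: mx_stable_span => v; rewrite !inE => /or3P[] /eqP ->.
  + rewrite [in A *m _]f2E Acomb; apply: (Ucomb 1); ring.
  (* Comparing f1 coordinates fixes the factor; the f4 coordinate is then off by
     [tens_det / (a1 * b2)]. *)
  + rewrite [in A *m _]f3E Acomb; apply: (Ucomb (b1 * a2 / (a1 * b2))).
      by field; rewrite b2_neq0 a1_neq0.
    apply/eqP; rewrite -subr_eq0; apply/eqP.
    transitivity (tens_det / (a1 * b2)); last by rewrite det_eq0 mul0r.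
    by rewrite /tens_det; field; rewrite b2_neq0 a1_neq0.
  (* The factor again comes from the f1 coordinate; the f4 error for [A g] is
     [c1 * tens_det2 / a1]. *)
  + rewrite Acomb; apply: (Ucomb ((a1 ^+ 2 * a2 + b1 * c1 * d2) / a1)).
      by field.
    apply/eqP; rewrite -subr_eq0; apply/eqP.
    transitivity (c1 * tens_det2 / a1); last by rewrite det2_eq0 mulr0 mul0r.
    by rewrite /tens_det2; field.
- apply: mx_stable_span => v; rewrite !inE => /or3P[] /eqP ->.
  + by rewrite [in D *m _]f2E Dcomb; apply: (Ucomb 0); ring.
  + by rewrite [in D *m _]f3E Dcomb; apply: (Ucomb 0); ring.
  + by rewrite Dcomb; apply: (Ucomb m); rewrite ?mulr0.
- by move=> U0; move: U2; rewrite U0 memv0 (negPf f2_neq0).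
- move=> Ufull; have := dim_span [:: f2; f3; g].
  by rewrite Ufull dimvf /dim /= muln1 leqNgt n_gt3.
Qed.

End Reducible.

Lemma tens_stable_trivialP :
  m != m2 -> m != m3 -> m2 != m3 -> a1 != 0 ->
  (forall v, exists x y z w, v = comb x y z w) ->
  tens_cv u1 v2 != 0 -> (3 < n1 * n2)%N ->
  (forall U, mx_stable U D -> mx_stable U A -> U = 0%VS \/ U = fullv) <->
  (tens_det != 0) || (tens_det2 != 0).
Proof.
move=> mm2 mm3 m23 a1_neq0 comb_span f2_neq0 n_gt3.
split=> [triv|det_neq0 U UD UA]; last exact: tens_stable_trivial.
rewrite -negb_and; apply/negP => /andP[/eqP det_eq0 /eqP det2_eq0].
have [U [UA UD U0 UF]] :=
  tens_stable_nontrivial a1_neq0 det_eq0 det2_eq0 f2_neq0 n_gt3.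
by case: (triv U UD UA).
Qed.

End TensorProduct.

(** * Specialization to the two-dimensional representations *)

Section Necklace3.
Variable F : fieldType.
Implicit Types (a b c d T t w : F).

Let e0 : 'cV[F]_2 := delta_mx 0 0.
Let e1 : 'cV[F]_2 := delta_mx 1 0.

Lemma mx2_e0 a b c d : mx2 a b c d *m e0 = a *: e0 + c *: e1.
Proof.
rewrite -colE; apply/matrixP => i j; rewrite !mxE (ord1 j).
by case: i => [[|[|//]] ?]; rewrite /= ?mulr1 ?mulr0 ?addr0 ?add0r.
Qed.

Lemma mx2_e1 a b c d : mx2 a b c d *m e1 = b *: e0 + d *: e1.
Proof.
rewrite -colE; apply/matrixP => i j; rewrite !mxE (ord1 j).
by case: i => [[|[|//]] ?]; rewrite /= ?mulr1 ?mulr0 ?addr0 ?add0r.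
Qed.

Lemma tens_comb_e01 (v : 'cV[F]_(2 * 2)) :
  exists x y z w, v = tens_comb e0 e1 e0 e1 x y z w.
Proof.
exists (v (mxtens_index (0, 0)) 0), (v (mxtens_index (0, 1)) 0),
  (v (mxtens_index (1, 0)) 0), (v (mxtens_index (1, 1)) 0).
apply/matrixP => i j; rewrite (ord1 j); case: (mxtens_indexP i) => i0 i1.
rewrite !mxE !mxtens_indexK /=.
case: i0 => [[|[|//]] ?]; case: i1 => [[|[|//]] ?];
rewrite /= !(mulr1, mulr0, addr0, add0r);
congr (v (mxtens_index (_, _)) _); exact/val_inj.
Qed.

Lemma tens_comb_e10 (v : 'cV[F]_(2 * 2)) :
  exists x y z w, v = tens_comb e0 e1 e1 e0 x y z w.
Proof.
have [x [y [z [w ->]]]] := tens_comb_e01 v; exists y, x, w, z.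
by apply/matrixP => i j; rewrite !mxE; ring.
Qed.

Lemma tens_cv_delta_neq0 (i j : 'I_2) :
  tens_cv (delta_mx i 0 : 'cV[F]_2) (delta_mx j 0 : 'cV[F]_2) != 0.
Proof.
apply/eqP => /matrixP/(_ (mxtens_index (i, j)) 0)/eqP.
by rewrite !mxE !mxtens_indexK /= !eqxx mulr1 oner_eq0.
Qed.

Section Criterion.
Variables (T1 t1 w1 c1 d1 T2 t2 w2 c2 d2 : F).
Hypotheses (t1_neq0 : t1 != 0) (t2_neq0 : t2 != 0).
Hypotheses (w1_neq0 : w1 != 0) (w2_neq0 : w2 != 0).
Hypotheses (c1_neq0 : c1 != 0) (c2_neq0 : c2 != 0).
Hypotheses (d1_neq0 : d1 != 0) (d2_neq0 : d2 != 0).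
Hypotheses (c1w1 : c1 != w1 * d1 ^+ 2).
Hypotheses (T1_cube : T1 ^+ 3 = 1) (T1_neq1 : T1 != 1).

Let tau := mx2 (T1 * t1) 0 0 t1 *t mx2 (T2 * t2) 0 0 t2 : 'M[F]_(2 * 2).
Let sigma := mx2 (w1 * d1) 1 c1 d1 *t mx2 (w2 * d2) 1 c2 d2 : 'M[F]_(2 * 2).

Let T1_neq0 : T1 != 0.
Proof. by apply: contra_eq_neq T1_cube => ->; rewrite expr0n /= eq_sym oner_eq0. Qed.

Let D0 : w1 * d1 ^+ 2 - c1 != 0.
Proof. by rewrite subr_eq0 eq_sym. Qed.

(** Once [r] vanishes, [e] reduces to [u * k] with [u] nonzero. It serves with [r] equal to
    [tens_det] and [e] equal to [tens_det2]. *)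
Let det_disj (x y u e k r s : F) : u != 0 -> x - y = r -> e = u * k + s * r ->
  (r != 0) || (e != 0) <-> k != 0 \/ x != y.
Proof.
move=> u0 <- ->; rewrite subr_eq0; have [->|xNy] := eqVneq x y; last first.
  by split=> // _; right.
by rewrite subrr mulr0 addr0 mulf_eq0 (negPf u0) /=; split; [left | case].
Qed.

(** With f1 and f4 the squares of the basis vectors, [T1 * T2 = 1] equates their eigenvalues. Up to
    [t1 * t2] the three eigenvalues are [1], [T1], [T1 ^+ 2], distinct since [T1] is a primitive
    cube root of unity. *)
Lemma opposite_irreducibleP : T1 * T2 = 1 ->
  (forall U, mx_stable U tau -> mx_stable U sigma -> U = 0%VS \/ U = fullv) <->
  w1 * w2 != 1 \/ w1 * d1 ^+ 2 * c2 != w2 * d2 ^+ 2 * c1.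
Proof.
move=> T12.
have T2E : T2 = T1 ^+ 2 by apply: (mulfI T1_neq0); rewrite T12 -exprS T1_cube.
have T2_neq1 : T2 != 1 by apply: contraNneq T1_neq1 => T2_1; rewrite -T12 T2_1 mulr1.
have T1_neqT2 : T1 != T2.
  apply: contraNneq T1_neq1 => T1T2; apply/eqP/(mulfI T1_neq0).
  by rewrite mulr1 -expr2 -T2E.
rewrite (tens_stable_trivialP (u1 := e0) (u2 := e1) (v1 := e0) (v2 := e1)
  (p1 := T1 * t1) (p2 := t1) (q1 := T2 * t2) (q2 := t2)
  (mx2_e0 _ _ _ _) (mx2_e1 _ _ _ _) (mx2_e0 _ _ _ _) (mx2_e1 _ _ _ _));
  rewrite ?oner_neq0 ?mulf_neq0 ?tens_cv_delta_neq0 //.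
- rewrite (eq_sym _ 1) -(subr_eq0 1).
  apply: (det_disj (u := d2 ^+ 2 * (w1 * d1 ^+ 2 - c1)) (s := w1)).
  + by rewrite mulf_neq0 ?expf_neq0.
  + by rewrite /tens_det; ring.
  + by rewrite /tens_det2 /tens_det; ring.
- by rewrite mx2_e0 scale0r addr0.
- by rewrite mx2_e1 scale0r add0r.
- by rewrite mx2_e0 scale0r addr0.
- by rewrite mx2_e1 scale0r add0r.
- by rewrite mulrACA T12 mul1r.
- rewrite -subr_eq0 (_ : _ - _ = T1 * t1 * t2 * (T2 - 1)); last by ring.
  by rewrite !mulf_neq0 ?subr_eq0.
- rewrite -subr_eq0 (_ : _ - _ = T2 * t1 * t2 * (T1 - 1)); last by ring.
  by rewrite !mulf_neq0 ?subr_eq0 // T2E expf_neq0.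
- rewrite -subr_eq0 (_ : _ - _ = t1 * t2 * (T1 - T2)); last by ring.
  by rewrite !mulf_neq0 ?subr_eq0.
- exact: tens_comb_e01.
Qed.

(* Exchanging the basis vectors of the second factor turns diag(T2 t2, t2) into
   T2 t2 diag(1/T2, 1), which gives this case the shape of the previous one. *)
Lemma equal_irreducibleP : T1 = T2 ->
  (forall U, mx_stable U tau -> mx_stable U sigma -> U = 0%VS \/ U = fullv) <->
  w1 != w2 \/ w1 * d1 ^+ 2 * c2 != w2 * d2 ^+ 2 * c1.
Proof.
move=> T1T2; rewrite /tau -T1T2.
rewrite (tens_stable_trivialP (u1 := e0) (u2 := e1) (v1 := e1) (v2 := e0)
  (p1 := T1 * t1) (p2 := t1) (q1 := t2) (q2 := T1 * t2)
  (a2 := d2) (b2 := c2) (c2 := 1) (d2 := w2 * d2)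
  (mx2_e0 _ _ _ _) (mx2_e1 _ _ _ _));
  rewrite ?oner_neq0 ?mulf_neq0 ?tens_cv_delta_neq0 //.
- rewrite (eq_sym w1) -(subr_eq0 w2).
  apply: (det_disj (u := w2 * d2 ^+ 2 * (w1 * d1 ^+ 2 - c1)) (s := w1)).
  + by rewrite !mulf_neq0 ?expf_neq0.
  + by rewrite /tens_det; ring.
  + by rewrite /tens_det2 /tens_det; ring.
- by rewrite mx2_e1 addrC.
- by rewrite mx2_e0 addrC.
- by rewrite mx2_e0 scale0r addr0.
- by rewrite mx2_e1 scale0r add0r.
- by rewrite mx2_e1 scale0r add0r.
- by rewrite mx2_e0 scale0r addr0.
- by rewrite mulrCA mulrA.
- rewrite -subr_eq0 (_ : _ - _ = T1 * t1 * t2 * (1 - T1)); last by ring.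
  by rewrite !mulf_neq0 // subr_eq0 eq_sym.
- rewrite -subr_eq0 (_ : _ - _ = t1 * t2 * (T1 - 1)); last by ring.
  by rewrite !mulf_neq0 ?subr_eq0.
(* f2 and f3 have eigenvalues in ratio [T1 ^+ 2], so [T1 = -1] must also be excluded; reducing
   [T1 ^+ 3] modulo [T1 + 1] does this. *)
- rewrite -subr_eq0 (_ : _ - _ = t1 * t2 * (T1 - 1) * (T1 + 1)); last by ring.
  rewrite !mulf_neq0 ?subr_eq0 //; apply: contra_neq T1_neq1 => TN1.
  rewrite -[RHS]T1_cube (_ : T1 ^+ 3 = (T1 + 1) * (T1 ^+ 2 - T1) + T1); last by ring.
  by rewrite TN1 mul0r add0r.
- exact: tens_comb_e10.
Qed.

End Criterion.

End Necklace3.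

(** * Roots of unity and assembly of the criterion *)

Lemma expi_third_neq1 (R : realType) (T : R[i]) :
  T = expi (2 * pi / 3) \/ T = expi (- (2 * pi / 3)) -> T != 1.
Proof.
(* The angle lies strictly between [0] and [pi], so [T] has nonzero imaginary part. *)
have s0 : 0 < sin (2 * pi / 3 : R).
  apply: sin_gt0_pi; have := pi_gt0 R; move: (pi : R) => p p0.
  by apply/andP; split; lra.
by case=> ->; rewrite eq_complex /= negb_and ?sinN ?oppr_eq0 (gt_eqF s0) orbT.
Qed.

Lemma expi_sixth_neq0 (R : realType) (w : R[i]) :
  w = expi (pi / 3) \/ w = expi (- (pi / 3)) -> w != 0.
Proof.
move=> /expi_sixth_root we; apply: contra_eq_neq we => ->.
by rewrite expr0n /= subrr add0r oner_neq0.
Qed.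

Theorem theorem3p16 (R : realType) (T1 T2 t1 t2 w1 w2 c1 c2 d1 d2 : R[i])
  (ht1 : t1 ^+ 6 = 1) (ht2 : t2 ^+ 6 = 1)
  (hT1 : T1 = expi (2 * pi / 3) \/ T1 = expi (- (2 * pi / 3)))
  (hT2 : T2 = expi (2 * pi / 3) \/ T2 = expi (- (2 * pi / 3)))
  (hw1 : w1 = expi (pi / 3) \/ w1 = expi (- (pi / 3)))
  (hw2 : w2 = expi (pi / 3) \/ w2 = expi (- (pi / 3)))
  (hd1 : d1 != 0) (hd2 : d2 != 0) (hc1 : c1 != 0) (hc2 : c2 != 0)
  (hcd1 : c1 != w1 * d1 ^+ 2) (hcd2 : c2 != w2 * d2 ^+ 2)
  (hT : (T1 = expi (2 * pi / 3) /\ T2 = expi (- (2 * pi / 3))) \/ T1 = T2)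
  (rho1 := rho (rho3_admissible ht1 hT1 hw1 hcd1))
  (rho2 := rho (rho3_admissible ht2 hT2 hw2 hcd2)) :
  irreducible (tensor_rep rho1 rho2) <->
  [\/ [/\ T1 = expi (2 * pi / 3), T2 = expi (- (2 * pi / 3)) & w1 * w2 != 1],
      [/\ T1 = expi (2 * pi / 3), T2 = expi (- (2 * pi / 3))
        & w1 * d1 ^+ 2 * c2 != w2 * d2 ^+ 2 * c1],
      [/\ T1 = T2, T1 = expi (2 * pi / 3) \/ T1 = expi (- (2 * pi / 3))
        & w1 != w2] |
      [/\ T1 = T2, T1 = expi (2 * pi / 3) \/ T1 = expi (- (2 * pi / 3))
        & w1 * d1 ^+ 2 * c2 != w2 * d2 ^+ 2 * c1]].
Proof.
have t_neq0 (t : R[i]) : t ^+ 6 = 1 -> t != 0.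
  by move=> t6; apply: contra_eq_neq t6 => ->; rewrite expr0n /= eq_sym oner_eq0.
have T1_neq1 := expi_third_neq1 hT1; have T1_cube := expi_cube_root hT1.
have w1_neq0 := expi_sixth_neq0 hw1; have w2_neq0 := expi_sixth_neq0 hw2.
have T_opp : T1 = expi (2 * pi / 3) -> T2 = expi (- (2 * pi / 3)) ->
    T1 * T2 = 1.
  by move=> -> ->; rewrite -expiD subrr expi0.
rewrite irreducible_necklaceP /=.
(* sigma_1 has index [0], so the powers of [T1] and [T2] in its matrices are [1]. *)
rewrite !rho_gen /= !expr0 invr1 !mulr1.
have oppositeP := opposite_irreducibleP (T2 := T2) w2
  (t_neq0 _ ht1) (t_neq0 _ ht2) w1_neq0 hc1 hc2 hd1 hd2 hcd1
  T1_cube T1_neq1.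
have equalP := equal_irreducibleP (T2 := T2)
  (t_neq0 _ ht1) (t_neq0 _ ht2) w1_neq0 w2_neq0 hc1 hc2 hd1 hd2 hcd1
  T1_cube T1_neq1.
split=> [[_ irr]|cond].
  (* [hT] selects the applicable criterion; in the converse, each condition itself names the
     case. *)
  case: hT => [[T1E T2E]|T12].
    by have [] := (oppositeP (T_opp T1E T2E)).1 irr; [constructor 1 | constructor 2].
  by have [] := (equalP T12).1 irr; [constructor 3 | constructor 4].
split=> //; case: cond => [[T1E T2E wN]|[T1E T2E wN]|[T12 _ wN]|[T12 _ wN]].
- by apply/(oppositeP (T_opp T1E T2E)); left.
- by apply/(oppositeP (T_opp T1E T2E)); right.
- by apply/(equalP T12); left.
- by apply/(equalP T12); right.
Qed.
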